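(* Let $x,y\in(0,1)$. The following conditions are equivalent: (a) the marked Schreier graphs $\Gamma_x$ and $\Gamma_y$ are isomorphic as abstract marked graphs (without selected vertex); (b) $x$ and $y$ belong to the same orbit of $F$; (c) $x$ and $y$ have binary expansions with the same tails.
   Context: Thompson's group $F$ is the group of all strictly increasing piecewise linear homeomorphisms of $[0,1]$ that are differentiable except at finitely many dyadic rationals and whose slopes are integer powers of $2$; products are read left to right, $(fg)(x)=g(f(x))$, and $x^f:=f(x)$. It is generated by $x_0,x_1$, where $x_0(t)=t/2$ on $[0,\frac12]$, $t-\frac14$ on $[\frac12,\frac34]$, $2t-1$ on $[\frac34,1]$; and $x_1(t)=t$ on $[0,\frac12]$, $\frac t2+\frac14$ on $[\frac12,\frac34]$, $t-\frac18$ on $[\frac34,\frac78]$, $2t-1$ on $[\frac78,1]$. The Schreier graph $\Gamma_x$ of the action of $F$ on the orbit of $x$ has the points of the orbit as vertices, with a directed edge labeled $s\in\{x_0,x_1\}$ from $y$ to $z$ iff $y^s=z$. An isomorphism of marked graphs is a graph isomorphism preserving edge orientation and the edge labels $x_0,x_1$ (names of vertices are not part of the structure). Having binary expansions with the same tails means: there are binary expansions $x=0.pu$ and $y=0.qu$ with finite (possibly empty, possibly of different lengths) words $p,q$ over $\{0,1\}$ and the same infinite word $u$ over $\{0,1\}$. *)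

(* Defs.v *)
From mathcomp Require Import all_boot all_order all_algebra.
From mathcomp Require Import all_classical all_reals all_analysis.
Set Implicit Arguments.
Unset Strict Implicit.
Unset Printing Implicit Defensive.
Import Order.TTheory GRing.Theory Num.Theory.
Import numFieldNormedType.Exports.
Local Open Scope classical_set_scope.
Local Open Scope ring_scope.

Definition dyadic (R : realType) (t : R) : Prop :=
  exists (m : int) (n : nat), t = m%:~R / 2 ^+ n.

(* Self-maps of [0, 1] are represented by functions R -> R of which only the
   restriction to [0, 1] matters. *)
Definition homeo01 (R : realType) (f : R -> R) : Prop :=
  exists g : R -> R,
    [/\ {homo f : t / t \in `[0, 1] >-> t \in `[0, 1]},
        {homo g : t / t \in `[0, 1] >-> t \in `[0, 1]},
        {in `[0, 1], cancel f g} /\ {in `[0, 1], cancel g f},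
        {within `[0, 1], continuous f} &
        {within `[0, 1], continuous g}].

Definition piecewise_linear01 (R : realType) (f : R -> R) : Prop :=
  exists2 s : seq R, itv_partition 0 1 s &
    forall i, (i < size s)%N -> exists a b : R,
      {in `[nth 0 (0 :: s) i, nth 0 s i], forall t, f t = a * t + b}.

Definition thompson_F (R : realType) : set (R -> R) :=
  [set f | [/\ homeo01 f,
               {in `[0, 1] &, {homo f : s t / s < t}},
               piecewise_linear01 f &
               exists2 s : seq R, (forall t, t \in s -> dyadic t) &
                 {in `]0, 1[, forall t, t \notin s ->
                    exists k : int, is_derive t (1 : R) f (2 ^ k)}]].

Definition F_orbit (R : realType) (x : R) : set R :=
  [set y | exists2 f : R -> R, thompson_F f & f x = y].

Inductive F_label := X0 | X1.

Definition F_gen (R : realType) (l : F_label) (t : R) : R :=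
  match l with
  | X0 => if t <= 1 / 2 then t / 2
          else if t <= 3 / 4 then t - 1 / 4
          else 2 * t - 1
  | X1 => if t <= 1 / 2 then t
          else if t <= 3 / 4 then t / 2 + 1 / 4
          else if t <= 7 / 8 then t - 1 / 8
          else 2 * t - 1
  end.

(* There is at most one edge with given label, source and target, so the
   labeled edges form a family of relations; distinct labels may give
   parallel edges, and loops are allowed. *)
Record marked_graph (L : Type) := MarkedGraph {
  vertex : Type;
  edge : L -> vertex -> vertex -> Prop
}.

Definition marked_graph_iso (L : Type) (G H : marked_graph L) : Prop :=
  exists2 phi : vertex G -> vertex H, bijective phi &
    forall l u v, edge l u v <-> edge l (phi u) (phi v).

Definition schreier_graph (R : realType) (x : R) : marked_graph F_label :=
  @MarkedGraph F_label (set_type (F_orbit x))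
    (fun l y z => F_gen l (set_val y) = set_val z).

Definition binary_expansion (R : realType) (x : R) (w : nat -> bool) : Prop :=
  [series (w k)%:R / 2 ^+ k.+1 : R]_k @ \oo --> x.

Definition cat_word (p : seq bool) (u : nat -> bool) (n : nat) : bool :=
  nth (u (n - size p)%N) p n.

Definition same_tails (R : realType) (x y : R) : Prop :=
  exists (p q : seq bool) (u : nat -> bool),
    binary_expansion x (cat_word p u) /\ binary_expansion y (cat_word q u).

(* Main.v *)
Require Import Defs.
From mathcomp Require Import all_boot all_order all_algebra.
From mathcomp Require Import all_classical all_reals all_analysis.
From mathcomp Require Import ring lra zify.
Set Implicit Arguments.
Unset Strict Implicit.
Unset Printing Implicit Defensive.
Import Order.TTheory GRing.Theory Num.Theory.
Import numFieldNormedType.Exports.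
Local Open Scope classical_set_scope.
Local Open Scope ring_scope.

(** All three conditions say that [y = 2 ^ k * x + d] for an integer [k] and a
    dyadic [d]; call this relation [dyadic_affine].  It is an equivalence
    relation.

    Tails.  Deleting the first binary digit of [s] in [0, 1) is the doubling
    map [s |-> 2 s mod 1].  Two points of [0, 1) are related by
    [dyadic_affine] iff some iterates of them under doubling coincide
    ([dyadic_affine_iter_doubling]): for large [N] the numbers [2 ^ N * t] and
    [2 ^ (N + k) * s] differ by an integer.  Equal iterates are equal tails.

    Orbits.  An element of F is [t |-> 2 ^ k * t + d] on each linear piece,
    where [d] is dyadic because it is [0] at the left end and can only change
    at a dyadic breakpoint, by a dyadic amount ([thompson_F_dyadic_affine]).
    Conversely, on binary words the generators give moves between [0.10bu] and
    [0.10u] for a digit [b], and bring each point of (0, 1) to the form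
    [0.10u]; hence two points of (0, 1) related by [dyadic_affine] are joined
    by a path in the Schreier graph ([dyadic_affine_F_connected]).  Composing
    the generators along the path gives an element of F ([F_connected_PL],
    [PL_thompson]).  So the orbit of [x] is its [dyadic_affine] class in (0, 1)
    ([F_orbitE]), and related points have the same Schreier graph.

    Graphs.  The loops labeled [X1] are exactly at the vertices [v <= 1 / 2],
    so an isomorphism [phi] preserves the condition [v <= 1 / 2].  It commutes
    with the generators, which are increasing, so it also preserves [v <= d]
    for each [d] joined to [1 / 2] by generators, that is for each dyadic [d]
    in (0, 1).  Since dyadics separate points, [phi v = v]
    ([schreier_iso_id]): the two orbits share a point, hence are equal. *)

(** * Dyadic affine equivalence and the doubling map *)

Lemma dyadic_int {R : realType} (m : int) : dyadic (m%:~R : R).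
Proof. by exists m, 0; rewrite expr0 divr1. Qed.

Lemma dyadic_exp2z {R : realType} (k : int) : dyadic (2 ^ k : R).
Proof.
case: k => n.
  by exists (2 ^+ n), 0; rewrite expr0 divr1 rmorphXn.
by exists 1, n.+1; rewrite NegzE -exprnN div1r.
Qed.

Lemma dyadicD {R : realType} (a b : R) : dyadic a -> dyadic b -> dyadic (a + b).
Proof.
move=> [m [n ->]] [m' [n' ->]].
exists (m * 2 ^+ n' + m' * 2 ^+ n), (n + n')%N.
rewrite rmorphD /= !rmorphM /= !rmorphXn /= exprD addf_div ?expf_neq0//.
Qed.

Lemma dyadicN {R : realType} (a : R) : dyadic a -> dyadic (- a).
Proof. by move=> [m [n ->]]; exists (- m), n; rewrite rmorphN mulNr. Qed.

Lemma dyadicM {R : realType} (a b : R) : dyadic a -> dyadic b -> dyadic (a * b).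
Proof.
move=> [m [n ->]] [m' [n' ->]]; exists (m * m'), (n + n')%N.
by rewrite rmorphM /= exprD mulf_div.
Qed.

Definition dyadic_affine {R : realType} (x y : R) : Prop :=
  exists (k : int) (d : R), dyadic d /\ y = 2 ^ k * x + d.

Lemma dyadic_affine_refl {R : realType} (x : R) : dyadic_affine x x.
Proof.
exists 0, 0; split; first exact: (dyadic_int 0).
by rewrite expr0z mul1r addr0.
Qed.

Lemma exp2zNK {R : realType} (k : int) : (2 : R) ^ (- k) * 2 ^ k = 1.
Proof. by rewrite -expfzDr// addNr expr0z. Qed.

Lemma dyadic_affine_sym {R : realType} (x y : R) :
  dyadic_affine x y -> dyadic_affine y x.
Proof.
move=> [k [d [dd ->]]]; exists (- k), (- (2 ^ (- k) * d)); split.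
  exact/dyadicN/dyadicM/dd/dyadic_exp2z.
by rewrite mulrDr mulrA exp2zNK mul1r addrK.
Qed.

Lemma dyadic_affine_trans {R : realType} (x y z : R) :
  dyadic_affine x y -> dyadic_affine y z -> dyadic_affine x z.
Proof.
move=> [k [d [dd ->]]] [l [e [de ->]]].
exists (l + k), (2 ^ l * d + e); split.
  by apply: dyadicD de; exact/dyadicM/dd/dyadic_exp2z.
by rewrite mulrDr mulrA expfzDr// addrA.
Qed.

Lemma dyadic_affine_dyadic {R : realType} (s t : R) :
  dyadic_affine s t -> dyadic s -> dyadic t.
Proof.
move=> [k [d [dd ->]]] ds; apply: dyadicD => //.
exact/dyadicM/ds/dyadic_exp2z.
Qed.

Definition doubling {R : realType} (s : R) : R :=
  if s < 1 / 2 then 2 * s else 2 * s - 1.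

Lemma iter_doubling {R : realType} (s : R) (n : nat) : 0 <= s < 1 ->
  (0 <= iter n doubling s < 1) /\
  exists m : int, iter n doubling s = 2 ^+ n * s - m%:~R.
Proof.
move=> s01; elim: n => [|n [/andP[t0 t1] [m tE]]] /=.
  by split=> //; exists 0; rewrite expr0 mul1r subr0.
move: (iter n _ s) t0 t1 tE => t t0 t1 tE.
split; first by rewrite /doubling; case: ltP => h; lra.
rewrite /doubling exprS; case: ltP => h.
  by exists (m + m); rewrite rmorphD /=; lra.
by exists (m + m + 1); rewrite !rmorphD /=; lra.
Qed.

(** The iterates of a point are its multiples by powers of 2 reduced modulo 1.
    Clearing the denominator of [t = 2 ^ k * s + m / 2 ^ n], and the negative
    part of [k], makes two such multiples differ by an integer, so their
    reductions agree. *)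
Lemma dyadic_affine_iter_doubling {R : realType} (s t : R) :
  0 <= s < 1 -> 0 <= t < 1 -> dyadic_affine s t ->
  exists M N : nat, iter M doubling s = iter N doubling t.
Proof.
move=> s01 t01 [k [d [[m [n ->]] ts]]].
have [M [N MN]] : exists M N : nat, exists j : int,
    (2 : R) ^+ N * t = 2 ^+ M * s + j%:~R.
  have kn : exists a b : nat, k = a%:Z - b%:Z.
    case: k {ts} => a; first by exists a, 0; rewrite subr0.
    by exists 0, a.+1; rewrite NegzE sub0r.
  case: kn => a [b kab]; exists (n + a)%N, (n + b)%N, (m * 2 ^+ b).
  have e2 : (2 : R) ^+ (n + b) * (2 ^ k) = 2 ^+ (n + a).
    by rewrite kab !exprnP -expfzDr//; congr (2 ^ _); lia.
  rewrite ts mulrDr mulrA e2; congr (_ + _).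
  rewrite rmorphM /= rmorphXn /= exprD.
  rewrite [_ * 2 ^+ b]mulrC -mulrA [2 ^+ n * _]mulrC mulfVK ?expf_neq0//.
  by rewrite mulrC.
exists M, N.
have [/andP[s0 s1] [ms sE]] := iter_doubling M s01.
have [/andP[t0 t1] [mt tE]] := iter_doubling N t01.
case: MN => j MN.
have diff : iter N doubling t - iter M doubling s = (j + ms - mt)%:~R.
  by rewrite rmorphB /= rmorphD /= sE tE MN; lra.
have : (-1)%:~R < (j + ms - mt)%:~R :> R by rewrite -diff; lra.
have : (j + ms - mt)%:~R < 1%:~R :> R by rewrite -diff; lra.
rewrite !ltr_int => h1 h2.
have z : (j + ms - mt) = 0 by lia.
by move: diff; rewrite z => /eqP; rewrite subr_eq0 => /eqP.
Qed.

(** * Paths of generators *)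

Definition F_gen_inv {R : realType} (l : F_label) (t : R) : R :=
  match l with
  | X0 => if t <= 1 / 4 then 2 * t
          else if t <= 1 / 2 then t + 1 / 4
          else (t + 1) / 2
  | X1 => if t <= 1 / 2 then t
          else if t <= 5 / 8 then 2 * t - 1 / 2
          else if t <= 3 / 4 then t + 1 / 8
          else (t + 1) / 2
  end.

Lemma F_genK {R : realType} (l : F_label) :
  cancel (F_gen l) (F_gen_inv l : R -> R).
Proof.
move=> t; case: l; rewrite [F_gen _ _]/F_gen; do !case: leP => ?;
  by rewrite /F_gen_inv; do !case: leP => ?; lra.
Qed.

Lemma F_gen_invK {R : realType} (l : F_label) :
  cancel (F_gen_inv l) (F_gen l : R -> R).
Proof.
move=> t; case: l; rewrite [F_gen_inv _ _]/F_gen_inv; do !case: leP => ?;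
  by rewrite /F_gen; do !case: leP => ?; lra.
Qed.

(** The formulas for the generators define increasing bijections of the whole
    line, which avoids restricting every statement below to [0, 1]. *)
Lemma F_gen_lt {R : realType} (l : F_label) :
  {mono (F_gen l : R -> R) : s t / s < t}.
Proof.
apply: leW_mono; apply: le_mono => s t st.
by case: l => /=; do !case: ifPn => ?; lra.
Qed.

Lemma F_gen01 {R : realType} (l : F_label) (t : R) :
  (0 < F_gen l t < 1) = (0 < t < 1).
Proof.
have e0 : F_gen l (0 : R) = 0 by case: (l) => /=; do !case: ifPn => ?; lra.
have e1 : F_gen l (1 : R) = 1 by case: (l) => /=; do !case: ifPn => ?; lra.
by rewrite -(F_gen_lt l 0 t) -(F_gen_lt l t 1) e0 e1.
Qed.

(** Existence of an undirected path in the Schreier graph. *)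
Inductive F_connected {R : realType} (u : R) : R -> Prop :=
| F_connected_refl : F_connected u u
| F_connected_gen l v : F_connected u v -> F_connected u (F_gen l v)
| F_connected_inv l v : F_connected u (F_gen l v) -> F_connected u v.

Lemma F_connected_trans {R : realType} (u v w : R) :
  F_connected u v -> F_connected v w -> F_connected u w.
Proof.
move=> uv; elim=> // [l z _|l z _]; first exact: F_connected_gen.
exact: F_connected_inv.
Qed.

Lemma F_connected_sym {R : realType} (u v : R) :
  F_connected u v -> F_connected v u.
Proof.
elim=> [|l z _ zu|l z _ zu]; first exact: F_connected_refl.
  apply: F_connected_trans zu; apply: (F_connected_inv (l := l)).
  exact: F_connected_refl.
apply: F_connected_trans zu; apply: F_connected_gen; exact: F_connected_refl.
Qed.

Lemma F_connected_step {R : realType} (l : F_label) (u v : R) :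
  F_gen l u = v -> F_connected u v.
Proof. by move=> <-; apply/F_connected_gen/F_connected_refl. Qed.

(** The point with binary expansion [0.10u], where [s = 0.u]. *)
Definition insert10 {R : realType} (s : R) : R := 1 / 2 + s / 4.

(** [0.100u] is the image of [0.10u] under [X1], and [0.101u] is the image of
    [0.110u] under [X1], while [X0] maps [0.110u] to [0.10u]. *)
Lemma F_connected_doubling {R : realType} (s : R) : 0 <= s < 1 ->
  F_connected (insert10 s) (insert10 (doubling s)).
Proof.
rewrite /insert10 /doubling => /andP[s0 s1]; case: ltP => h.
  apply: F_connected_sym; apply: (F_connected_step (l := X1)) => /=.
  by do !case: leP => ?; lra.
apply: (@F_connected_trans _ _ (5 / 8 + s / 4)).
  apply: F_connected_sym; apply: (F_connected_step (l := X1)) => /=.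
  by do !case: leP => ?; lra.
by apply: (F_connected_step (l := X0)) => /=; do !case: leP => ?; lra.
Qed.

Lemma F_connected_iter_doubling {R : realType} (n : nat) (s : R) :
  0 <= s < 1 -> F_connected (insert10 s) (insert10 (iter n doubling s)).
Proof.
move=> s01; elim: n => [|n IH]; first exact: F_connected_refl.
apply: F_connected_trans IH _; apply: F_connected_doubling.
by have [] := iter_doubling n s01.
Qed.

(** Near 1, [X0] doubles the distance to 1; near 0, its inverse doubles the
    distance to 0.  Repeating this brings a point of (0, 1) to the fundamental
    domain [1/2, 3/4), which is the set of the points [0.10u]. *)
Lemma F_connected_insert10 {R : realType} (x : R) : 0 < x < 1 ->
  exists2 s, 0 <= s < 1 & F_connected x (insert10 s).
Proof.
have mid (t : R) : 1 / 2 <= t < 3 / 4 ->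
    exists2 s, 0 <= s < 1 & F_connected t (insert10 s).
  move=> /andP[t1 t2]; exists (4 * t - 2); first lra.
  by have -> : insert10 (4 * t - 2) = t; [rewrite /insert10; lra
                                        |exact: F_connected_refl].
have right n (t : R) : 1 / 2 <= t < 1 -> 1 / 2 < 2 ^+ n * (1 - t) ->
    exists2 s, 0 <= s < 1 & F_connected t (insert10 s).
  elim: n t => [|n IH] t /andP[t1 t2] nt; first by move: nt; rewrite expr0; lra.
  have [t3|t3] := ltP t (3 / 4); first by apply: mid; lra.
  have [||s s01 cs] := IH (2 * t - 1); [lra|by move: nt; rewrite exprS; lra|].
  exists s => //; apply: F_connected_trans cs.
  apply: (F_connected_step (l := X0)) => /=.
  by do !case: leP => ?; lra.
have left n (t : R) : 0 < t < 1 / 2 -> 1 / 2 < 2 ^+ n * t ->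
    exists2 s, 0 <= s < 1 & F_connected t (insert10 s).
  elim: n t => [|n IH] t /andP[t1 t2] nt; first by move: nt; rewrite expr0; lra.
  have [t3|t3] := ltP t (1 / 4).
    have [||s s01 cs] := IH (2 * t); [lra|by move: nt; rewrite exprS; lra|].
    exists s => //; apply: F_connected_trans cs.
    apply: F_connected_sym; apply: (F_connected_step (l := X0)) => /=.
    by do !case: leP => ?; lra.
  have [|s s01 cs] := mid (t + 1 / 4); first lra.
  exists s => //; apply: F_connected_trans cs.
  apply: F_connected_sym; apply: (F_connected_step (l := X0)) => /=.
  by do !case: leP => ?; lra.
have big (e : R) : 0 < e -> exists n : nat, 1 / 2 < 2 ^+ n * e.
  move=> e0; exists (Num.Def.archi_bound e^-1).
  apply: (@lt_trans _ _ 1); first lra.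
  by rewrite -ltr_pdivrMr// div1r; exact: upper_nthrootP.
move=> /andP[x0 x1]; have [xh|xh] := ltP x (1 / 2).
  by have [n xn] := big _ x0; apply: (left n) => //; lra.
have [|n xn] := big (1 - x); first lra.
by apply: (right n) => //; lra.
Qed.

(** * Piecewise dyadic affine homeomorphisms of the line *)

(** Breakpoints are described by the intervals that avoid them rather than by
    a subdivision, so that composing two maps needs no common refinement: the
    union of the two sets of breakpoints, suitably transported, is enough.
    Degenerate intervals [a = b] are included, so that the condition also says
    that each point is related to its image. *)
Definition dyadic_affine_off {R : realType} (D : seq R) (f : R -> R) : Prop :=
  forall a b : R, a <= b -> {in D, forall t, t <= a \/ b <= t} ->
    exists (k : int) (d : R), dyadic d /\
      forall t, a <= t <= b -> f t = 2 ^ k * t + d.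

Record dyadic_PL_homeo {R : realType} (f g : R -> R) (D : seq R) : Prop :=
  DyadicPLHomeo {
    PL_cancel : cancel f g;
    PL_cancel_inv : cancel g f;
    PL_lt : {mono f : s t / s < t};
    PL_0 : f 0 = 0;
    PL_1 : f 1 = 1;
    PL_dyadic : forall t, t \in D -> dyadic t;
    PL_off : dyadic_affine_off D f }.

Lemma PL_le {R : realType} (f g : R -> R) (D : seq R) :
  dyadic_PL_homeo f g D -> {mono f : s t / s <= t}.
Proof. by move=> H s t; rewrite !leNgt (PL_lt H). Qed.

Lemma PL_dyadic_affine {R : realType} (f g : R -> R) (D : seq R) (t : R) :
  dyadic_PL_homeo f g D -> dyadic_affine t (f t).
Proof.
move=> H; have [|k [d [dd fE]]] := PL_off H (lexx t).
  by move=> u _; apply/orP; exact: le_total.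
by exists k, d; rewrite fE// lexx.
Qed.

Lemma PL_comp {R : realType} (f g f' g' : R -> R) (D D' : seq R) :
  dyadic_PL_homeo f g D -> dyadic_PL_homeo f' g' D' ->
  dyadic_PL_homeo (f' \o f) (g \o g') (D ++ map g D').
Proof.
move=> H H'; split=> /=.
- exact: can_comp (PL_cancel H') (PL_cancel H).
- exact: can_comp (PL_cancel_inv H) (PL_cancel_inv H').
- by move=> s t /=; rewrite (PL_lt H') (PL_lt H).
- by rewrite (PL_0 H) (PL_0 H').
- by rewrite (PL_1 H) (PL_1 H').
- move=> t; rewrite mem_cat => /orP[/(PL_dyadic H)//|/mapP[u uD' ->]].
  apply: dyadic_affine_dyadic (PL_dyadic H' uD').
  apply: dyadic_affine_sym; rewrite -{2}(PL_cancel_inv H u).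
  exact: PL_dyadic_affine H.
move=> a b ab off.
have [t tD|k [d [dd fE]]] := PL_off H ab.
  by apply: off; rewrite mem_cat tD.
have [||l [e [de f'E]]] := PL_off H' (a := f a) (b := f b).
  by rewrite (PL_le H).
  move=> u uD'; rewrite -(PL_cancel_inv H u) !(PL_le H); apply: off.
  by rewrite mem_cat map_f ?orbT.
exists (l + k), (2 ^ l * d + e); split.
  by apply: dyadicD de; exact/dyadicM/dd/dyadic_exp2z.
move=> t tab /=; rewrite f'E; last by rewrite !(PL_le H).
by rewrite fE// mulrDr mulrA expfzDr// addrA.
Qed.

Lemma PL_inv {R : realType} (f g : R -> R) (D : seq R) :
  dyadic_PL_homeo f g D -> dyadic_PL_homeo g f (map f D).
Proof.
move=> H.
have glt : {mono g : s t / s < t}.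
  by move=> s t; rewrite -(PL_lt H) !(PL_cancel_inv H).
split=> //.
- exact: PL_cancel_inv H.
- exact: PL_cancel H.
- by rewrite -[in LHS](PL_0 H) (PL_cancel H).
- by rewrite -[in LHS](PL_1 H) (PL_cancel H).
- move=> _ /mapP[u uD ->]; apply: dyadic_affine_dyadic (PL_dyadic H uD).
  exact: PL_dyadic_affine H.
move=> a b ab off.
have gle : {mono g : s t / s <= t} by move=> s t; rewrite !leNgt glt.
have [||k [d [dd fE]]] := PL_off H (a := g a) (b := g b); first by rewrite gle.
  by move=> u uD; rewrite -(PL_cancel H u) !gle; apply: off; exact: map_f.
exists (- k), (- (2 ^ (- k) * d)); split.
  exact/dyadicN/dyadicM/dd/dyadic_exp2z.
move=> t tab; have := fE (g t); rewrite !gle => /(_ tab).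
rewrite (PL_cancel_inv H) => tE.
by rewrite {2}tE mulrDr mulrA exp2zNK mul1r addrK.
Qed.

Lemma PL_gen {R : realType} (l : F_label) :
  dyadic_PL_homeo (F_gen l) (F_gen_inv l : R -> R) [:: 1 / 2; 3 / 4; 7 / 8].
Proof.
have d4 (m : int) : dyadic (m%:~R / 4 : R) by exists m, 2; congr (_ / _); lra.
have d8 (m : int) : dyadic (m%:~R / 8 : R) by exists m, 3; congr (_ / _); lra.
split.
- exact: F_genK.
- exact: F_gen_invK.
- exact: F_gen_lt.
- by case: l => /=; do !case: ifPn => ?; lra.
- by case: l => /=; do !case: ifPn => ?; lra.
- move=> t; rewrite !inE => /or3P[] /eqP ->.
    by exists 1, 1; rewrite expr1.
    exact: (d4 3).
  exact: (d8 7).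
move=> a b ab off.
have eN1 : (2 : R) ^ (-1) = 1 / 2 by rewrite exprN1 div1r.
have /off h1 : (1 / 2 : R) \in [:: 1 / 2; 3 / 4; 7 / 8]
  by rewrite !inE eqxx.
have /off h2 : (3 / 4 : R) \in [:: 1 / 2; 3 / 4; 7 / 8]
  by rewrite !inE eqxx orbT.
have /off h3 : (7 / 8 : R) \in [:: 1 / 2; 3 / 4; 7 / 8]
  by rewrite !inE eqxx !orbT.
case: l => /=.
  case: h1 => h1; last first.
    exists (-1), 0; split; first exact: (dyadic_int 0).
    by move=> t /andP[ta tb]; rewrite {}eN1; do !case: ifPn => ?; lra.
  case: h2 => h2.
    exists 1, (-1); split; first exact: (dyadic_int (-1)).
    by move=> t /andP[ta tb]; rewrite {eN1} expr1z; do !case: ifPn => ?; lra.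
  exists 0, ((-1)%:~R / 4); split; first exact: d4.
  by move=> t /andP[ta tb]; rewrite {eN1} expr0z; do !case: ifPn => ?; lra.
case: h1 => h1; last first.
  exists 0, 0; split; first exact: (dyadic_int 0).
  by move=> t /andP[ta tb]; rewrite {eN1} expr0z; do !case: ifPn => ?; lra.
case: h2 => h2; last first.
  exists (-1), (1%:~R / 4); split; first exact: d4.
  by move=> t /andP[ta tb]; rewrite {}eN1; do !case: ifPn => ?; lra.
case: h3 => h3.
  exists 1, (-1); split; first exact: (dyadic_int (-1)).
  by move=> t /andP[ta tb]; rewrite {eN1} expr1z; do !case: ifPn => ?; lra.
exists 0, ((-1)%:~R / 8); split; first exact: d8.
by move=> t /andP[ta tb]; rewrite {eN1} expr0z; do !case: ifPn => ?; lra.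
Qed.

Lemma F_connected_PL {R : realType} (u v : R) : F_connected u v ->
  exists f g D, dyadic_PL_homeo f g D /\ f u = v.
Proof.
elim=> [|l w _ [f [g [D [H fu]]]]|l w _ [f [g [D [H fu]]]]].
- exists id, id, [::]; split=> //; split=> // a b _ _.
  exists 0, 0; split; first exact: (dyadic_int 0).
  by move=> t _; rewrite expr0z mul1r addr0.
- do 3 eexists; split; first exact: PL_comp H (PL_gen l).
  by rewrite /= fu.
- do 3 eexists; split; first exact: PL_comp H (PL_inv (PL_gen l)).
  by rewrite /= fu F_genK.
Qed.

Lemma F_connected_dyadic_affine {R : realType} (u v : R) :
  F_connected u v -> dyadic_affine u v.
Proof.
by move=> /F_connected_PL[f [g [D [H <-]]]]; exact: PL_dyadic_affine H.
Qed.

(** Both points are joined to points [0.10u] and [0.10v]; deleting digits from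
    [u] and [v] by [F_connected_doubling] until the tails agree joins them. *)
Lemma dyadic_affine_F_connected {R : realType} (x y : R) :
  0 < x < 1 -> 0 < y < 1 -> dyadic_affine x y -> F_connected x y.
Proof.
move=> /F_connected_insert10[s s01 xs] /F_connected_insert10[t t01 yt] xy.
have ins (r : R) : dyadic_affine r (insert10 r).
  exists (-2), (1 / 2); split; first by exists 1, 1; rewrite expr1.
  have -> : (2 : R) ^ (-2) = 1 / 4 by rewrite -[-2]/(- Posz 2) -exprnN; lra.
  rewrite /insert10; lra.
have [|M [N MN]] := dyadic_affine_iter_doubling s01 t01.
  apply: dyadic_affine_trans (ins s) _.
  apply: dyadic_affine_trans (dyadic_affine_sym (ins t)).
  have sx := dyadic_affine_sym (F_connected_dyadic_affine xs).
  apply: dyadic_affine_trans sx _.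
  exact: dyadic_affine_trans xy (F_connected_dyadic_affine yt).
apply: F_connected_trans xs _; apply: F_connected_trans (F_connected_sym yt).
apply: F_connected_trans (F_connected_iter_doubling M s01) _; rewrite MN.
exact/F_connected_sym/F_connected_iter_doubling.
Qed.

(** * Piecewise dyadic affine homeomorphisms belong to F *)

Lemma PL_within_continuous {R : realType} (f g : R -> R) (D : seq R) :
  dyadic_PL_homeo f g D -> {within `[0, 1], continuous f}.
Proof.
move=> H; have H' := PL_inv H.
apply: segment_inc_surj_continuous; first by move=> s t _ _; exact: PL_le H s t.
move=> t /=; rewrite in_itv /= => tab.
exists (g t); last exact: PL_cancel_inv H t.
rewrite in_itv /= -(PL_le H 0) -(PL_le H _ 1) (PL_cancel_inv H).
by rewrite (PL_0 H) (PL_1 H) in tab *.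
Qed.

Lemma PL_itv {R : realType} (f g : R -> R) (D : seq R) :
  dyadic_PL_homeo f g D -> {homo f : t / t \in `[0, 1] >-> t \in `[0, 1]}.
Proof.
by move=> H t; rewrite !in_itv /= -{2}(PL_0 H) -{2}(PL_1 H) !(PL_le H).
Qed.

(** The partition consists of the breakpoints inside (0, 1) in increasing
    order, followed by 1; consecutive points have no breakpoint in between. *)
Lemma PL_partition {R : realType} (f g : R -> R) (D : seq R) :
  dyadic_PL_homeo f g D -> piecewise_linear01 f.
Proof.
move=> H; pose s' := sort <=%R (undup [seq t <- D | 0 < t < 1]).
have s'_mem (t : R) : (t \in s') = (0 < t < 1) && (t \in D).
  by rewrite mem_sort mem_undup mem_filter.
pose s := rcons s' 1.
have s_mem (t : R) : (t \in s) = (t == 1) || ((0 < t < 1) && (t \in D)).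
  by rewrite mem_rcons inE s'_mem.
have s_path : path <%R 0 s.
  rewrite rcons_path; apply/andP; split.
    rewrite path_min_sorted ?sort_lt_sorted ?undup_uniq//.
    by apply/allP => t; rewrite s'_mem => /andP[/andP[]].
  have := mem_last 0 s'; rewrite inE s'_mem => /orP[/eqP->//|].
  by move=> /andP[/andP[]].
exists s; first by split; rewrite ?last_rcons.
move=> i si.
have ss : sorted <%R (0 :: s) by [].
have nlt := lt_sorted_ltn_nth 0 ss.
have i1 : nth 0 (0 :: s) i < nth 0 s i.
  by rewrite -[nth 0 s i]/(nth 0 (0 :: s) i.+1) nlt// inE /= ltnS// ltnW.
have nth01 j : (j < (size s).+1)%N -> 0 <= nth 0 (0 :: s) j <= 1.
  case: j => [|j js] /=; first by rewrite lexx ler01.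
  have : nth 0 s j \in s by exact: mem_nth.
  rewrite s_mem => /orP[/eqP->|/andP[/andP[/ltW-> /ltW->]]]//.
  by rewrite ler01 lexx.
have [|k [d [_ fE]]] := PL_off H (ltW i1).
  move=> t tD; have [//|ta] := leP t (nth 0 (0 :: s) i); first by left.
  have [//|tb] := leP (nth 0 s i) t; first by right.
  exfalso.
  have ts : t \in s.
    rewrite s_mem tD andbT; apply/orP; right.
    have /andP[h0 _] := nth01 i (leqW si).
    have /andP[_ h1] := nth01 i.+1 si.
    by rewrite (le_lt_trans h0 ta) (lt_le_trans tb h1).
  have [j js tE] : exists2 j, (j < size s)%N & t = nth 0 (0 :: s) j.+1.
    by exists (index t s); [rewrite index_mem|rewrite /= nth_index].
  rewrite -[nth 0 s i]/(nth 0 (0 :: s) i.+1) in tb.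
  by move: ta tb; rewrite tE !nlt ?inE//= ?ltnS; [lia|exact: ltnW].
exists (2 ^ k), d => t; rewrite in_itv /=; exact: fE.
Qed.

Lemma finite_gap {R : realType} (D : seq R) (t : R) : t \notin D ->
  exists2 e, 0 < e & {in D, forall u, u <= t - e \/ t + e <= u}.
Proof.
elim: D => [|u D IH]; first by exists 1.
rewrite inE negb_or => /andP[tu /IH[e e0 eD]].
exists (Num.min e `|t - u|).
  by rewrite lt_min e0 normr_gt0 subr_eq0.
have me : Num.min e `|t - u| <= e by rewrite ge_min lexx.
have mu : Num.min e `|t - u| <= `|t - u| by rewrite ge_min lexx orbT.
move: (Num.min _ _) me mu => m me mu v; rewrite inE => /orP[/eqP ->|/eD[]h].
- by have [h|h] := leP u t; [left; move: mu; rewrite ger0_norm|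
    right; move: mu; rewrite ltr0_norm]; lra.
- left; lra.
- right; lra.
Qed.

Lemma PL_is_derive {R : realType} (f g : R -> R) (D : seq R) (t : R) :
  dyadic_PL_homeo f g D -> t \notin D ->
  exists k : int, is_derive t (1 : R) f (2 ^ k).
Proof.
move=> H /finite_gap[e e0 eD].
have [|//|k [d [_ fE]]] := PL_off H (a := t - e) (b := t + e); first lra.
have lin : is_derive t (1 : R) (fun u : R => 2 ^ k * u + d) (2 ^ k).
  by apply: is_derive_eq; rewrite addr0 /GRing.scale /= mulr1.
exists k; apply: near_eq_is_derive lin; near=> u; apply/esym/fE.
have : `|t - u| < e by near: u; exact: cvgr_dist_lt.
by rewrite ltr_norml => /andP[]; lra.
Unshelve. all: by end_near.
Qed.

Lemma PL_thompson {R : realType} (f g : R -> R) (D : seq R) :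
  dyadic_PL_homeo f g D -> thompson_F f.
Proof.
move=> H; split.
- exists g; split.
  + exact: PL_itv H.
  + exact: PL_itv (PL_inv H).
  + by split=> t _; [exact: PL_cancel H t|exact: PL_cancel_inv H t].
  + exact: PL_within_continuous H.
  + exact: PL_within_continuous (PL_inv H).
- by move=> s t _ _; rewrite (PL_lt H).
- exact: PL_partition H.
- exists D; first exact: PL_dyadic H.
  by move=> t _; exact: PL_is_derive H.
Qed.

(** * Elements of F are dyadic affine at each point *)

(** The point may be an end of the interval: a derivative is also a one-sided
    derivative, and this is what rules out a change of slope at a point where
    the function is differentiable. *)
Lemma is_derive_affine {R : realType} (f : R -> R) (a b c t u v : R) :
  u < v -> u <= t <= v -> {in `[u, v], forall s, f s = a * s + b} ->
  is_derive t (1 : R) f c -> c = a.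
Proof.
move=> uv /andP[ut tv] fE [fd fc]; apply/eqP/negPn/negP => ca.
have e0 : 0 < `|c - a| by rewrite normr_gt0 subr_eq0.
move/cvg_ex: (fd) => [l /= fl].
have lc : l = c by rewrite -fc; apply/esym/cvg_lim.
move: fl; rewrite lc => /cvgrPdist_lt/(_ _ e0)/nbhs_ballP[d /= d0 hd].
have [h [hn0 hd' huv]] : exists h : R, [/\ h != 0, `|h| < d & u <= h + t <= v].
  have m0 : 0 < Num.min (d / 2) (v - u) / 2 by rewrite divr_gt0// lt_min; lra.
  have md : Num.min (d / 2) (v - u) <= d / 2 by rewrite ge_min lexx.
  have mv : Num.min (d / 2) (v - u) <= v - u by rewrite ge_min lexx orbT.
  move: (Num.min _ _) m0 md mv => m m0 md mv.
  have [tm|tm] := leP t ((u + v) / 2).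
    by exists (m / 2); rewrite gt_eqF// gtr0_norm//; split=> //; lra.
  exists (- (m / 2)); rewrite oppr_eq0 gt_eqF// normrN gtr0_norm//.
  by split=> //; lra.
have := hd h; rewrite /ball /= sub0r normrN => /(_ hd' hn0).
rewrite -[h *: 1]/(h * 1) mulr1 /=.
rewrite !fE ?in_itv/= ?ut//.
have -> : h^-1 *: (a * (h + t) + b - (a * t + b)) = a.
  rewrite -[_ *: _]/(h^-1 * _).
  have -> : a * (h + t) + b - (a * t + b) = h * a by ring.
  by rewrite mulKf.
by rewrite ltxx.
Qed.

Lemma exists_notin {R : realType} (S : seq R) (u v : R) : u < v ->
  exists2 t, u < t < v & t \notin S.
Proof.
elim: S v => [|x S IH] v uv; first by exists ((u + v) / 2) => //; lra.
have [t tuv tS] := IH v uv; have [tx|tx] := eqVneq t x; last first.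
  by exists t => //; rewrite inE negb_or tx.
have [|t' t'ut t'S] := IH t; first lra.
exists t'; first lra.
by rewrite inE negb_or t'S andbT -tx lt_eqF//; lra.
Qed.

Lemma thompson_F_fix01 {R : realType} (f : R -> R) :
  thompson_F f -> f 0 = 0 /\ f 1 = 1.
Proof.
move=> [[g [f01 g01 [_ gK] _ _]] flt _ _].
have i0 : (0 : R) \in `[0, 1] by rewrite in_itv /= lexx ler01.
have i1 : (1 : R) \in `[0, 1] by rewrite in_itv /= lexx ler01.
have fle : {in `[0, 1] &, {homo f : s t / s <= t}}.
  move=> s t si ti; rewrite le_eqVlt => /orP[/eqP->//|st].
  exact/ltW/flt.
have := f01 _ i0; have := f01 _ i1.
rewrite !in_itv /= => /andP[_ f1] /andP[f0 _].
have := g01 _ i0; have := g01 _ i1 => g1 g0; split.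
  apply/eqP; rewrite eq_le f0 andbT -[leRHS]gK//; apply: fle => //.
  by move: g0; rewrite in_itv => /andP[].
apply/eqP; rewrite eq_le f1 /= -[leLHS]gK//; apply: fle => //.
by move: g1; rewrite in_itv => /andP[].
Qed.

(** The pieces given by piecewise linearity may end at points that are not
    dyadic, and nothing is known beforehand of their slopes and intercepts.
    The slope of a piece is a power of 2 by differentiability at one of its
    interior points.  Intercepts are dyadic by induction from the left: at a
    common end outside the finite set of dyadic exceptions both slopes equal
    the derivative, so the intercept does not change; at an exception the
    intercept changes by a dyadic amount. *)
Lemma thompson_F_dyadic_affine {R : realType} (f : R -> R) (x : R) :
  thompson_F f -> 0 < x < 1 -> dyadic_affine x (f x).
Proof.
move=> fF /andP[x0 x1]; have [f0 _] := thompson_F_fix01 fF.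
case: fF => _ _ [s [s_path /eqP s_last] s_aff] [S S_dyadic S_der].
have s_sorted : sorted <%R (0 :: s) by [].
have nlt := lt_sorted_ltn_nth 0 s_sorted.
have nle := lt_sorted_leq_nth 0 s_sorted.
have s_lt i : (i < size s)%N -> nth 0 (0 :: s) i < nth 0 s i.
  move=> si; rewrite -[nth 0 s i]/(nth 0 (0 :: s) i.+1).
  by rewrite nlt// inE /= ltnS// ltnW.
have s_le1 i : (i < size s)%N -> nth 0 s i <= 1.
  move=> si; rewrite -s_last (last_nth 0).
  by rewrite -[nth 0 s i]/(nth 0 (0 :: s) i.+1) nle ?inE//=.
have s_ge0 i : (i < size s)%N -> 0 <= nth 0 (0 :: s) i.
  move=> si; rewrite -[X in X <= _]/(nth 0 (0 :: s) 0).
  by rewrite nle ?inE//= ltnW.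
have slope i : (i < size s)%N -> exists (k : int) (b : R),
    {in `[nth 0 (0 :: s) i, nth 0 s i], forall t, f t = 2 ^ k * t + b}.
  move=> si; have [a [b fE]] := s_aff i si.
  have [t tuv tS] := exists_notin S (s_lt i si).
  have [|k ft] := S_der t _ tS.
    by rewrite in_itv /=; have := s_ge0 i si; have := s_le1 i si; lra.
  exists k, b; rewrite (is_derive_affine (s_lt i si) _ fE ft)//.
  by case/andP: tuv => /ltW-> /ltW->.
have piece i : (i < size s)%N -> exists (k : int) (b : R), dyadic b /\
    {in `[nth 0 (0 :: s) i, nth 0 s i], forall t, f t = 2 ^ k * t + b}.
  elim: i => [|i IH] si.
    have [k [b fE]] := slope 0%N si; exists k, b; split=> //.
    have := fE 0; rewrite in_itv /= lexx (ltW (s_lt 0%N si)).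
    rewrite f0 mulr0 add0r => <-//.
    exact: (dyadic_int 0).
  have si' := ltnW si; have [k [b [db fE]]] := IH si'.
  have [l [c fE']] := slope i.+1 si; exists l, c; split=> //.
  have p1 := s_lt i si'; have p2 := s_lt i.+1 si; rewrite /= in p2.
  set p := nth 0 s i in p1 p2 fE fE'.
  have cE : c = 2 ^ k * p + b - 2 ^ l * p.
    have e1 : f p = 2 ^ k * p + b by apply: fE; rewrite in_itv /= lexx ltW.
    have e2 : f p = 2 ^ l * p + c by apply: fE'; rewrite in_itv /= -/p lexx ltW.
    by rewrite -e1 e2 addrAC subrr add0r.
  have [pS|pS] := boolP (p \in S).
    have dp := S_dyadic _ pS; rewrite cE; apply: dyadicD; last first.
      exact/dyadicN/dyadicM/dp/dyadic_exp2z.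
    by apply: dyadicD => //; exact/dyadicM/dp/dyadic_exp2z.
  have [|m fp] := S_der p _ pS.
    rewrite in_itv /= (le_lt_trans (s_ge0 i si') p1) (lt_le_trans p2)//.
    exact: s_le1.
  have ek : (2 : R) ^ m = 2 ^ k.
    by apply: (is_derive_affine p1 _ fE fp); rewrite lexx ltW.
  have el : (2 : R) ^ m = 2 ^ l.
    by apply: (is_derive_affine p2 _ fE' fp); rewrite /= -/p lexx ltW.
  by rewrite cE -ek -el addrAC subrr add0r.
have hx : has (>= x) s.
  apply/hasP; exists (last 0 s); last by rewrite /= s_last ltW.
  case: (s) s_last => [|a q _ /=]; last exact: mem_last.
  by move=> /eqP; rewrite /= eq_sym oner_eq0.
have := hx; rewrite has_find => fi.
have [k [b [db fE]]] := piece _ fi; exists k, b; split=> //.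
apply: fE; rewrite in_itv /= (nth_find 0 hx) andbT.
case E : (find _ s) => [|j] /=; first exact: ltW.
have /(before_find 0)/negbT : (j < find (>= x) s)%N by rewrite E.
by rewrite -ltNge => /ltW.
Qed.

(** * Orbits and isomorphisms of Schreier graphs *)

Lemma F_orbitE {R : realType} (x y : R) : 0 < x < 1 ->
  F_orbit x y <-> 0 < y < 1 /\ dyadic_affine x y.
Proof.
move=> x01; split.
  move=> [f fF <-]; split; last exact: thompson_F_dyadic_affine.
  have [f0 f1] := thompson_F_fix01 fF; case: fF => _ flt _ _.
  case/andP: x01 => x0 x1; rewrite -{1}f0 -{1}f1.
  by rewrite !flt// in_itv /= ?lexx ?ler01 ?ltW.
move=> [y01 /(dyadic_affine_F_connected x01 y01)].
move=> /F_connected_PL[f [g [D [H fx]]]].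
by exists f => //; exact: PL_thompson H.
Qed.

Lemma F_orbit_gen {R : realType} (x v : R) (l : F_label) : 0 < x < 1 ->
  F_orbit x (F_gen l v) <-> F_orbit x v.
Proof.
move=> x01; rewrite !F_orbitE// F_gen01.
have vl := PL_dyadic_affine v (PL_gen l).
split=> -[v01 xv]; split=> //; last exact: dyadic_affine_trans xv vl.
exact: dyadic_affine_trans xv (dyadic_affine_sym vl).
Qed.

(** The order of the orbit can be read off the graph.  The vertices
    [v <= 1 / 2] are those with a loop labeled [X1]; transporting this set
    along paths of generators gives the sets of vertices [v <= d], for all
    dyadic [d] in (0, 1). *)
Lemma schreier_iso_id {R : realType} (x y : R)
    (phi : set_type (F_orbit x) -> set_type (F_orbit y)) :
  0 < x < 1 -> 0 < y < 1 ->
  (forall l u v, F_gen l (set_val u) = set_val v <->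
                 F_gen l (set_val (phi u)) = set_val (phi v)) ->
  forall v, set_val (phi v) = set_val v.
Proof.
move=> x01 y01 phiE.
have in01 (z : R) (z01 : 0 < z < 1) (v : set_type (F_orbit z)) :
    0 < set_val v < 1.
  by have /(F_orbitE _ z01)[] := set_valP v.
(* [X1] also fixes 1, hence the bound on [t]. *)
have fixX1 (t : R) : t < 1 -> F_gen X1 t = t <-> t <= 1 / 2.
  move=> t1; split=> [e|h /=]; last by rewrite h.
  by rewrite leNgt; apply/negP => h; move: e => /=; do !case: ifPn => ?; lra.
have half v : (set_val v <= 1 / 2) = (set_val (phi v) <= 1 / 2).
  have /andP[_ v1] := in01 _ x01 v; have /andP[_ w1] := in01 _ y01 (phi v).
  apply/idP/idP => [/(fixX1 _ v1)/phiE/(fixX1 _ w1)//|].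
  by move=> /(fixX1 _ w1)/phiE/(fixX1 _ v1).
have cut d : F_connected (1 / 2) d ->
    forall v, (set_val v <= d) = (set_val (phi v) <= d).
  have genle l : {mono (F_gen l : R -> R) : s t / s <= t}.
    by move=> s t; rewrite !leNgt F_gen_lt.
  elim=> // [l e _ IH v|l e _ IH v].
    have wP : F_orbit x (F_gen_inv l (set_val v)).
      by apply/(F_orbit_gen _ l x01); rewrite F_gen_invK; exact: set_valP.
    pose w : set_type (F_orbit x) := SigSub (mem_set wP).
    have wv : F_gen l (set_val w) = set_val v by rewrite /= F_gen_invK.
    by rewrite -wv -(proj1 (phiE l w v) wv) !genle.
  have wP : F_orbit x (F_gen l (set_val v)).
    by apply/F_orbit_gen => //; exact: set_valP.
  pose w : set_type (F_orbit x) := SigSub (mem_set wP).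
  have vw : F_gen l (set_val v) = set_val w by [].
  by rewrite -(genle l) vw IH -(proj1 (phiE l v w) vw) genle.
(* For [1 < 2 ^ N * (t - s)] some multiple of [1 / 2 ^ N] lies between. *)
have sep (s t : R) : 0 < s -> t < 1 -> s < t ->
    exists2 d, F_connected (1 / 2) d & s <= d < t.
  move=> s0 t1 st.
  pose N := Num.Def.archi_bound (t - s)^-1.
  have hN : 1 < 2 ^+ N * (t - s).
    rewrite -ltr_pdivrMr ?subr_gt0// div1r; exact: upper_nthrootP.
  pose m := Num.floor (2 ^+ N * s).
  have e0 : (0 : R) < 2 ^+ N by rewrite exprn_gt0.
  have m1 : m%:~R <= 2 ^+ N * s by exact: floor_le_tmp.
  have m2 : 2 ^+ N * s < (m + 1)%:~R by exact: floorD1_gt.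
  have sd : s < (m + 1)%:~R / 2 ^+ N by rewrite ltr_pdivlMr// mulrC.
  have dt : (m + 1)%:~R / 2 ^+ N < t by rewrite ltr_pdivrMr//; lra.
  exists ((m + 1)%:~R / 2 ^+ N); last by rewrite dt ltW.
  apply: dyadic_affine_F_connected; [lra|lra|].
  exists 0, ((m + 1)%:~R / 2 ^+ N - 1 / 2); split; last by rewrite expr0z; lra.
  apply: dyadicD; first by exists (m + 1), N.
  by apply: dyadicN; exists 1, 1; rewrite expr1.
move=> v; apply/eqP; rewrite eq_le; apply/andP.
have /andP[v0 v1] := in01 _ x01 v; have /andP[w0 w1] := in01 _ y01 (phi v).
split; rewrite leNgt; apply/negP => /sep[]// d /cut/(_ v) + /andP[d1 d2].
  by rewrite d1 leNgt d2.
by rewrite d1 leNgt d2.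
Qed.

(** * Binary expansions *)

Definition binary_digit {R : realType} (x : R) (n : nat) : bool :=
  1 / 2 <= iter n doubling x.

(** The remainder after [n] digits is the [n]-th iterate of [x] under doubling,
    scaled by [2 ^ - n]. *)
Lemma binary_digit_expansion {R : realType} (x : R) :
  0 <= x < 1 -> binary_expansion x (binary_digit x).
Proof.
move=> x01.
have sumE n : [series (binary_digit x k)%:R / 2 ^+ k.+1 : R]_k n =
    x - iter n doubling x / 2 ^+ n.
  rewrite /series /=; elim: n => [|n IH].
    by rewrite big_geq// expr0 divr1 subrr.
  rewrite big_nat_recr//= IH /binary_digit exprS.
  have e0 : (2 : R) ^+ n != 0 by rewrite expf_neq0.
  move: (iter n _ x) (2 ^+ n) e0 => t e e0; rewrite /doubling.
  by case: ltP => _ /=; field.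
apply/cvgrPdist_lt => e e0.
exists (Num.Def.archi_bound e^-1) => // n /= Nn.
have [/andP[t0 t1] _] := iter_doubling n x01.
have p0 : (0 : R) < 2 ^+ n by rewrite exprn_gt0.
rewrite sumE opprB addrC subrK ger0_norm; last by rewrite divr_ge0// ltW.
rewrite ltr_pdivrMr//; apply: lt_le_trans t1 _.
rewrite mulrC -ler_pdivrMr// div1r; apply/ltW; exact: upper_nthrootP.
Qed.

Lemma binary_expansion_behead {R : realType} (x : R) (w : nat -> bool) :
  binary_expansion x w -> binary_expansion (2 * x - (w 0%N)%:R) (w \o S).
Proof.
rewrite /binary_expansion => xw.
have -> : [series ((w \o S) k)%:R / 2 ^+ k.+1 : R]_k =
    (fun n => 2 * [series (w k)%:R / 2 ^+ k.+1 : R]_k n.+1 - (w 0%N)%:R).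
  apply/funext => n; rewrite /series /= big_nat_recl// mulrDr expr1.
  rewrite mulrCA mulfV// mulr1 addrAC subrr add0r mulr_sumr.
  by apply: eq_bigr => k _; rewrite [in RHS]exprS invfM mulrCA mulVKf.
apply: cvgB; last exact: cvg_cst.
by apply: cvgM; [exact: cvg_cst|rewrite cvg_shiftS].
Qed.

(** Deleting a digit [b] in front replaces [x] by [2 * x - b]. *)
Lemma binary_expansion_tail {R : realType} (x : R) (p : seq bool) u :
  binary_expansion x (cat_word p u) ->
  exists2 z, binary_expansion z u & dyadic_affine x z.
Proof.
elim: p x => [|b p IH] x xw.
  exists x; last exact: dyadic_affine_refl.
  congr (binary_expansion _ _): xw; apply/funext => n.
  by rewrite /cat_word /= subn0 nth_nil.
have [|z zu xz] := IH (2 * x - b%:R); first exact: binary_expansion_behead xw.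
exists z => //; apply: dyadic_affine_trans xz.
exists 1, (- b%:R); split; last by rewrite expr1z.
exact/dyadicN/(dyadic_int b).
Qed.

Lemma same_tails_dyadic_affine {R : realType} (x y : R) :
  same_tails x y -> dyadic_affine x y.
Proof.
move=> [p [q [u [/binary_expansion_tail[z zu xz]]]]].
move=> /binary_expansion_tail[z' zu' yz'].
have zz' : z = z' by exact: cvg_unique zu zu'.
by apply: dyadic_affine_trans xz _; rewrite zz'; exact: dyadic_affine_sym.
Qed.

Lemma binary_digit_cat {R : realType} (x : R) (n : nat) :
  cat_word (mkseq (binary_digit x) n) (binary_digit (iter n doubling x)) =
  binary_digit x.
Proof.
apply/funext => k; rewrite /cat_word size_mkseq.
have [kn|nk] := ltnP k n; first by rewrite nth_mkseq.
by rewrite nth_default ?size_mkseq// /binary_digit -iterD subnK.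
Qed.

Lemma dyadic_affine_same_tails {R : realType} (x y : R) :
  0 <= x < 1 -> 0 <= y < 1 -> dyadic_affine x y -> same_tails x y.
Proof.
move=> x01 y01 /(dyadic_affine_iter_doubling x01 y01)[M [N MN]].
exists (mkseq (binary_digit x) M), (mkseq (binary_digit y) N).
exists (binary_digit (iter M doubling x)); split; last rewrite MN.
  by rewrite binary_digit_cat; exact: binary_digit_expansion.
by rewrite binary_digit_cat; exact: binary_digit_expansion.
Qed.

Unset Implicit Arguments.

Theorem corollary5p6 (R : realType) (x y : R)
    (hx : 0 < x < 1) (hy : 0 < y < 1) :
  [<-> marked_graph_iso (schreier_graph x) (schreier_graph y);
       F_orbit x y;
       same_tails x y].
Proof.
have orbit_refl : F_orbit x x.
  by apply/F_orbitE => //; split=> //; exact: dyadic_affine_refl.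
tfae.
- move=> [phi _ phiE].
  pose v : set_type (F_orbit x) := SigSub (mem_set orbit_refl).
  have phi_id := schreier_iso_id hx hy phiE v.
  apply/F_orbitE => //; split=> //; apply: dyadic_affine_sym.
  have : F_orbit y (set_val (phi v)) by exact: set_valP.
  by rewrite phi_id => /(F_orbitE _ hy)[_].
- move=> /(F_orbitE _ hx)[_ xy].
  by apply: dyadic_affine_same_tails => //; lra.
move=> /same_tails_dyadic_affine xy.
rewrite /schreier_graph; have -> : F_orbit x = F_orbit y.
  apply/funext => z; apply/propext; rewrite !F_orbitE//.
  split=> -[z01 h]; split=> //; last exact: dyadic_affine_trans xy h.
  exact: dyadic_affine_trans (dyadic_affine_sym xy) h.
by exists id => //; exists id.
Qed.
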